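(* There exists a context-free monoid none of whose maximal subgroups is finitely generated. *)

(* Defs.v *)
From Stdlib Require Import List.
From mathcomp Require Import all_boot.
Set Implicit Arguments. Unset Strict Implicit. Unset Printing Implicit Defensive.

Record monoid := Monoid {
  mcarrier :> Type;
  mmul : mcarrier -> mcarrier -> mcarrier;
  mone : mcarrier;
  mmulA : forall x y z, mmul x (mmul y z) = mmul (mmul x y) z;
  mmul1m : forall x, mmul mone x = x;
  mmulm1 : forall x, mmul x mone = x }.

Definition mword (M : monoid) (A : Type) (pi : A -> M) (w : seq A) : M :=
  foldr (fun a m => mmul (pi a) m) (mone M) w.

Record cfgrammar (S : finType) := CFG {
  nonterm : finType;
  start : nonterm;
  rules : seq (nonterm * seq (nonterm + S)) }.

Inductive derives (S : finType) (G : cfgrammar S) : nonterm G -> seq S -> Prop :=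
| derives_rule n rhs w : (n, rhs) \in rules G -> derives_form rhs w -> derives n w
with derives_form (S : finType) (G : cfgrammar S) : seq (nonterm G + S) -> seq S -> Prop :=
| df_nil : derives_form [::] [::]
| df_term a f w : derives_form f w -> derives_form (inr a :: f) (a :: w)
| df_nonterm n f u w : derives n u -> derives_form f w ->
    derives_form (inl n :: f) (u ++ w).

Definition cf_language (S : finType) (L : seq S -> Prop) : Prop :=
  exists G : cfgrammar S, forall w, L w <-> @derives S G (start G) w.

(* Word problem of M w.r.t. pi : A -> M, over the alphabet A + {#}
   (# encoded as None): { u # v^rev | u, v in A^*, u =_M v }. *)
Definition word_problem (M : monoid) (A : finType) (pi : A -> M)
  (w : seq (option A)) : Prop :=
  exists u v : seq A, mword pi u = mword pi v /\
    w = map Some u ++ None :: map Some (rev v).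

Definition context_free_monoid (M : monoid) : Prop :=
  exists (A : finType) (pi : A -> M),
    (forall m : M, exists u : seq A, mword pi u = m) /\
    cf_language (word_problem pi).

Definition idempotent_elt (M : monoid) (e : M) : Prop := mmul e e = e.

(* H-class of e : x R e (xM = eM) and x L e (Mx = Me). For e idempotent this
   is the maximal subgroup of M containing e, with identity e. *)
Definition Hclass (M : monoid) (e x : M) : Prop :=
  (exists s, x = mmul e s) /\ (exists t, e = mmul x t) /\
  (exists s, x = mmul s e) /\ (exists t, e = mmul t x).

Definition fg_maximal_subgroup (M : monoid) (e : M) : Prop :=
  exists gs : seq M, (forall g, In g gs -> Hclass e g) /\
    forall x, Hclass e x ->
      exists zs : seq M,
        (forall z, In z zs ->
           In z gs \/ exists2 g, In g gs &
             (Hclass e z /\ mmul g z = e /\ mmul z g = e)) /\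
        x = foldr (@mmul M) e zs.

(* Main.v *)
(** Let M = < a, b, c | (a b^n c)^2 = 1 (n >= 0) >, with U_n = a b^n c.  Relators
overlap only in U_n U_n U_n, so rewriting U_n U_n -> 1 gives unique normal
forms.  Comparing the two factorisations of w in the reduction of w w to w shows
that an idempotent has the form p q with q p = 1, so its maximal subgroup is
isomorphic to the group of units.  An irreducible word that is invertible is a
product of words U_n; hence the units form the free product of the groups
<U_n> of order 2, which is not finitely generated: products of U_n with n < N
never reduce to U_N.  The nested shape
a (b^n c a b^n) c of U_n U_n makes the set of words equal to 1 context-free, and
two words are equal iff both arise from one irreducible word by inserting words
equal to 1, which is a context-free condition on u # v^rev. *)

Require Import Defs.
From Stdlib Require Import List.
From mathcomp Require Import all_boot.
From mathcomp Require Import zify.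
Set Implicit Arguments. Unset Strict Implicit. Unset Printing Implicit Defensive.

(** * Words [a b^n c], relators and reduction on a stack *)

Notation letter := (option bool).
Notation la := (Some true : letter).
Notation lb := (None : letter).
Notation lc := (Some false : letter).

Definition unitw n : seq letter := la :: rcons (nseq n lb) lc.
Definition relator n := unitw n ++ unitw n.

Lemma unitw_rcons n : unitw n = rcons (la :: nseq n lb) lc.
Proof. by []. Qed.

Lemma cat_nseq_rcons x n :
  x ++ la :: nseq n.+1 lb = rcons (x ++ la :: nseq n lb) lb.
Proof. by rewrite -(addn1 n) nseqD rcons_cat rcons_cons cats1. Qed.

(** The last [c] ends both blocks, and the run of [b] before it, stopped by an [a], determines the
    exponent. *)
Lemma eq_cat_unitw x y n m : x ++ unitw n = y ++ unitw m -> x = y /\ n = m.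
Proof.
rewrite !unitw_rcons -!rcons_cat => /rcons_inj[].
elim: n m => [|n IHn] [|m]; rewrite ?cat_nseq_rcons ?cats1 => /rcons_inj[] //.
by move=> /IHn[-> ->].
Qed.

Lemma eq_cat_relator x y n m : x ++ relator n = y ++ relator m -> x = y /\ n = m.
Proof. by rewrite !catA => /eq_cat_unitw[/eq_cat_unitw]. Qed.

Lemma size_relator n : size (relator n) = (n.+2).*2.
Proof. by rewrite size_cat /= size_rcons size_nseq addnn. Qed.

(** One step of a stack machine: append [x], then erase the relator ending the word, if there is
    one. [find] returns [size w] when its search fails. *)
Definition push (s : seq letter) (x : letter) : seq letter :=
  let w := rcons s x in
  let n := find (fun n => suffix (relator n) w) (iota 0 (size w)) in
  if n < size w then take (size w - size (relator n)) w else w.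

Variant push_spec s x : seq letter -> Prop :=
| PushReduce n t of rcons s x = t ++ relator n : push_spec s x t
| PushKeep of (forall n t, rcons s x <> t ++ relator n) :
    push_spec s x (rcons s x).

Lemma pushP s x : push_spec s x (push s x).
Proof.
rewrite /push; set w := rcons s x; set P := fun n => _.
have [lt_n|le_n] := ltnP.
  have Pn : P (find P (iota 0 (size w))).
    have h : has P (iota 0 (size w)) by rewrite has_find size_iota.
    have := nth_find 0 h; rewrite nth_iota //.
  move: (find P _) Pn => n /suffixP[t def_w]; apply: (PushReduce (n := n)).
  by rewrite -/w def_w size_cat addnK take_size_cat.
apply: PushKeep => n t def_w.
have : has P (iota 0 (size w)).
  apply/hasP; exists n; last by apply/suffixP; exists t.
  (* [relator n] is longer than [n], so searching below [size w] misses no relator. *)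
  by rewrite mem_iota /= /w def_w size_cat size_relator; lia.
by rewrite has_find size_iota ltnNge le_n.
Qed.

Lemma push_relator s x n t : rcons s x = t ++ relator n -> push s x = t.
Proof.
case: pushP => [m t' -> /eq_cat_relator[]|no_redex /no_redex] //.
Qed.

Lemma push_neq_c s x : x != lc -> push s x = rcons s x.
Proof.
case: pushP => // n t.
by rewrite /relator {2}unitw_rcons -!rcons_cat => /rcons_inj[_ ->].
Qed.

Definition irreducible w := forall x n y, w <> x ++ relator n ++ y.

Lemma irreducible_factor x y z : irreducible (x ++ y ++ z) -> irreducible y.
Proof. by move=> irr u n v def_y; apply: (irr (x ++ u) n (v ++ z)); rewrite def_y -!catA. Qed.

Lemma irreducible_catl x y : irreducible (x ++ y) -> irreducible x.
Proof. exact: (@irreducible_factor [::]). Qed.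

Lemma irreducible_catr x y : irreducible (x ++ y) -> irreducible y.
Proof. by rewrite -{1}(cats0 y); apply: irreducible_factor. Qed.

Lemma irreducible_rconsl x c : irreducible (rcons x c) -> irreducible x.
Proof. by rewrite -cats1 => /irreducible_catl. Qed.

Lemma irreducible_nil : irreducible [::].
Proof. by case. Qed.

Lemma push_irreducible_eq s x : irreducible (rcons s x) -> push s x = rcons s x.
Proof. by case: pushP => // n t -> /(_ t n [::]); rewrite cats0. Qed.

Lemma irreducible_push s x : irreducible s -> irreducible (push s x).
Proof.
move=> irr; case: pushP => [n t|no_redex u n v].
  rewrite /relator unitw_rcons -!rcons_cat => /rcons_inj[def_s _].
  by move: irr; rewrite def_s => /irreducible_catl.
elim/last_ind: v => [|v y _]; first by rewrite cats0; apply: no_redex.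
by rewrite -!rcons_cat => /rcons_inj[/irr].
Qed.

Lemma irreducible_foldl s w : irreducible s -> irreducible (foldl push s w).
Proof. by elim: w s => //= x w IHw s /irreducible_push/IHw. Qed.

Lemma foldl_push_ab s n : foldl push s (la :: nseq n lb) = s ++ la :: nseq n lb.
Proof.
elim: n => [|n IHn]; first by rewrite /= push_neq_c // cats1.
have := cat_nseq_rcons [::] n; rewrite !cat0s => ->.
by rewrite foldl_rcons IHn push_neq_c // rcons_cat.
Qed.

Lemma foldl_push_unitw s n : foldl push s (unitw n) = push (s ++ la :: nseq n lb) lc.
Proof. by rewrite unitw_rcons -cats1 foldl_cat foldl_push_ab. Qed.

(** This is confluence at the overlap [U_n U_n U_n]. Either the first [U_n] stays on the stack and
    the second cancels it, or the first cancels a [U_n] ending [s] and the second puts it back. *)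
Lemma foldl_push_relator s n : irreducible s -> foldl push s (relator n) = s.
Proof.
move=> irr; rewrite foldl_cat !foldl_push_unitw.
case: (pushP (s ++ _)) => [m t|no_redex].
  rewrite rcons_cat -unitw_rcons catA => /eq_cat_unitw[def_s ->].
  by rewrite push_irreducible_eq rcons_cat -unitw_rcons -def_s.
by apply: (@push_relator _ _ n); rewrite !rcons_cat -!unitw_rcons -catA.
Qed.

(** * Normal forms and their compatibility with concatenation *)

Definition nf := foldl push [::].

Lemma irreducible_nf w : irreducible (nf w).
Proof. by apply: irreducible_foldl; apply: irreducible_nil. Qed.

Lemma nf_irreducible w : irreducible w -> nf w = w.
Proof.
elim/last_ind: w => // w x IHw irr.
rewrite /nf foldl_rcons -/(nf w) IHw; first exact: push_irreducible_eq.
exact: irreducible_rconsl irr.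
Qed.

Lemma nf_id w : nf (nf w) = nf w.
Proof. exact/nf_irreducible/irreducible_nf. Qed.

Lemma nf_idP w : nf w = w -> irreducible w.
Proof. by move=> <-; apply: irreducible_nf. Qed.

(** Computing [nf w] only deletes relators, and reading a relator leaves an irreducible stack
    unchanged. *)
Lemma foldl_push_nf s w : irreducible s -> foldl push s (nf w) = foldl push s w.
Proof.
move=> irr; elim/last_ind: w => // w x IHw.
rewrite /nf !foldl_rcons -/(nf w) -IHw.
case: pushP => [n t def_w|]; last by rewrite foldl_rcons.
rewrite -foldl_rcons def_w foldl_cat foldl_push_relator //.
exact: irreducible_foldl.
Qed.

Lemma nf_cat u v : nf (u ++ v) = foldl push (nf u) v.
Proof. exact: foldl_cat. Qed.

Lemma nf_catl u v : nf (nf u ++ v) = nf (u ++ v).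
Proof. by rewrite !nf_cat nf_id. Qed.

Lemma nf_catr u v : nf (u ++ nf v) = nf (u ++ v).
Proof. by rewrite !nf_cat foldl_push_nf //; apply: irreducible_nf. Qed.

Lemma nf_relator x n y : nf (x ++ relator n ++ y) = nf (x ++ y).
Proof.
rewrite catA nf_cat (nf_cat x) foldl_push_relator -?nf_cat //.
exact: irreducible_nf.
Qed.

(** * Cancellation in a product of two irreducible words *)

(* Holds along the prefixes of products of the words [unitw n]. *)
Definition prefix_rel : rel letter := fun x y => (x == lc) ==> (y == la).
(* Holds along the suffixes of such products. *)
Definition suffix_rel : rel letter := fun x y => (y == la) ==> (x == lc).

Lemma path_unitw_cat (r : rel letter) x n w :
    r la lb -> r lb lb -> r la lc -> r lb lc ->
  path r x (unitw n ++ w) = r x la && path r lc w.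
Proof.
move=> ab bb ac bc; rewrite /unitw /= cat_rcons; congr (_ && _).
have rc : r (if n is 0 then la else lb) lc by case: n.
case: n rc => [|n] rc /=; rewrite ?ac ?ab //=.
by elim: n {rc} => [|n IHn] /=; rewrite ?bc ?bb.
Qed.

Lemma prefix_rel_relator n : path prefix_rel lc (relator n).
Proof. by rewrite -(cats0 (relator n)) -catA !path_unitw_cat. Qed.

Lemma suffix_rel_relator n : path suffix_rel lc (rcons (relator n) la).
Proof. by rewrite -cats1 -catA !path_unitw_cat. Qed.

Lemma cat_eq_cat (T : Type) (x y z t : seq T) :
  x ++ y = z ++ t -> size z <= size x -> exists2 w, x = z ++ w & t = w ++ y.
Proof.
elim: z x => [|c z IHz] [|d x] //=; first by exists [::].
- by move=> <-; exists (d :: x).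
by move=> [-> /IHz eq_xz] /eq_xz[w -> ->]; exists w.
Qed.

(* If [u v = 1] then [q = u] and [r = v], so a right (left) invertible irreducible
   word satisfies the first (second) path condition. *)
Lemma irreducible_mul u v : irreducible u -> irreducible v ->
  exists p q r s, [/\ u = p ++ q, v = r ++ s, nf (u ++ v) = p ++ s,
    nf (q ++ r) = [::] &
    path prefix_rel lc q /\ path suffix_rel lc (rcons r la)].
Proof.
move=> irr_u; elim/last_ind: v => [_|v x IHv irr_v].
  by exists u, [::], [::], [::]; rewrite !cats0 nf_irreducible.
have [p [q [r [s [def_u def_v def_uv qr1 [pq pr]]]]]] :=
  IHv (irreducible_rconsl irr_v).
have -> : nf (u ++ rcons v x) = push (p ++ s) x.
  by rewrite -rcons_cat /nf foldl_rcons -/(nf _) def_uv.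
case: pushP => [n t|no_redex]; last first.
  by exists p, q, r, (rcons s x); rewrite def_v !rcons_cat.
rewrite rcons_cat => def_ps.
(* The relator must begin inside [p]: otherwise it would be a factor of the irreducible word
   [rcons v x]. *)
have [p' def_p def_R] : exists2 p', p = t ++ p' & relator n = p' ++ rcons s x.
  have [|lt_pt] := leqP (size t) (size p); first exact: cat_eq_cat.
  have [z _ def_s] := cat_eq_cat (esym def_ps) (ltnW lt_pt).
  have /(_ z n [::]) : irreducible (rcons s x).
    by apply: (irreducible_catr (x := r)); rewrite -rcons_cat -def_v.
  by rewrite cats0.
(* All of [rcons v x] is now cancelled: with [q r = 1] removed from the middle, [p' q r s x] becomes
   the relator [p' s x]. *)
exists t, (p' ++ q), (rcons v x), [::]; split.
- by rewrite def_u def_p catA.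
- by rewrite cats0.
- by rewrite cats0.
- rewrite def_v rcons_cat -catA (catA q) -nf_catr -(nf_catl (q ++ r)) qr1 /= nf_catr.
  by rewrite -def_R -[relator n]cats0 (nf_relator [::]).
split.
  have := prefix_rel_relator n; rewrite def_R !cat_path => /andP[-> _] /=.
  (* A nonempty [q] starts with [a], which may follow any letter under [prefix_rel]. *)
  by case: (q) pq => //= y q' /andP[ya ->]; rewrite andbT; apply/implyP.
have := suffix_rel_relator n; rewrite def_R rcons_cat cat_path => /andP[_].
rewrite def_v rcons_cat rcons_cat cat_path.
(* [r] is empty or ends in [c], after which [suffix_rel] allows any letter. *)
move: pr; rewrite rcons_path => /andP[-> /= /eqP->].
by case: (s) => [|y s'] /= /andP[_ ->]; rewrite andbT; apply/implyP.
Qed.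

(** The first condition puts an [a] at the start and after each [c]; the second forbids any other
    [a] and, through the final [a], makes a nonempty word end in [c]. So each [a] opens a block
    [a b^n c], which [scan] cuts off. *)
Lemma path_unitw w :
    path prefix_rel lc w -> path suffix_rel lc (rcons w la) ->
  exists ns, w = flatten (map unitw ns).
Proof.
have scan x v : x != lc -> path prefix_rel x v -> path suffix_rel x (rcons v la) ->
    exists n v', [/\ v = nseq n lb ++ lc :: v', path prefix_rel lc v'
      & path suffix_rel lc (rcons v' la)].
  elim: v x => [|y v IHv] x /negPf xc /=; rewrite {1}/suffix_rel xc //.
  case: y IHv => [[|]|] IHv //= /andP[_ pv]; first by exists 0, v.
  move=> /IHv[] // n [v' [-> pv' sv']].
  by exists n.+1, v'.
have [k] := ubnP (size w); elim: k w => // k IHk [|x w] /=; first by exists [::].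
rewrite ltnS => lt_w /andP[xa pw] /andP[_ sw].
have {xa} def_x : x = la by apply/eqP; move: xa; rewrite /prefix_rel eqxx.
move: pw sw; rewrite {x}def_x => pw sw.
have [//|n [v [def_w pv sv]]] := scan la w _ pw sw.
have [|//|//|ns def_v] := IHk v.
  by apply: leq_trans lt_w; rewrite def_w size_cat /=; lia.
by exists (n :: ns); rewrite /= cat_rcons -def_v -def_w.
Qed.

(** On index lists, reduction is that of a free product of groups of order 2: equal neighbours
    cancel, and no new index appears. *)
Lemma nf_flatten_unitw ns : exists2 ms, {subset ms <= ns} &
  nf (flatten (map unitw ns)) = flatten (map unitw ms).
Proof.
elim/last_ind: ns => [|ns n [ms sub_ms def_ns]]; first by exists [::].
rewrite map_rcons flatten_rcons nf_cat def_ns foldl_push_unitw.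
case: pushP => [m t|_]; rewrite rcons_cat -unitw_rcons; last first.
  exists (rcons ms n); last by rewrite map_rcons flatten_rcons.
  by move=> i; rewrite !mem_rcons !inE => /orP[->//|/sub_ms->]; rewrite orbT.
rewrite catA => /eq_cat_unitw[].
elim/last_ind: ms sub_ms def_ns => [|ms i _] sub_ms _.
  by move=> /(congr1 size); rewrite size_cat /=; lia.
rewrite map_rcons flatten_rcons => /eq_cat_unitw[<- _] _.
exists ms => // j j_ms; rewrite mem_rcons inE sub_ms ?orbT //.
by rewrite mem_rcons inE j_ms orbT.
Qed.

Arguments unitw : simpl never.

Lemma nf_unitw n : nf (unitw n) = unitw n.
Proof.
rewrite /nf foldl_push_unitw; case: pushP => // m t.
rewrite rcons_cat -unitw_rcons catA => /eq_cat_unitw[/(congr1 size)].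
by rewrite size_cat /unitw /= => /eqP; rewrite addnS.
Qed.

(** * The monoid of normal forms *)

Definition nfword := {w : seq letter | nf w == w}.

Definition mk (w : seq letter) : nfword := exist _ (nf w) (introT eqP (nf_id w)).

Definition nfmul (x y : nfword) : nfword := mk (val x ++ val y).

(** Membership in [nfword] is a boolean equation, so its proofs cannot distinguish elements. *)
Lemma eq_mk u v : nf u = nf v -> mk u = mk v.
Proof. by move=> eq_uv; apply: val_inj. Qed.

Lemma mk_val x : mk (val x) = x.
Proof. by apply: val_inj; apply/eqP/(valP x). Qed.

Lemma nfmul_mk u v : nfmul (mk u) (mk v) = mk (u ++ v).
Proof. by apply: eq_mk; rewrite /= nf_catl nf_catr. Qed.

Lemma nfmulA x y z : nfmul x (nfmul y z) = nfmul (nfmul x y) z.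
Proof. by rewrite -(mk_val x) -(mk_val y) -(mk_val z) !nfmul_mk catA. Qed.

Lemma nfmul1m x : nfmul (mk [::]) x = x.
Proof. by rewrite -(mk_val x) nfmul_mk. Qed.

Lemma nfmulm1 x : nfmul x (mk [::]) = x.
Proof. by rewrite -(mk_val x) nfmul_mk cats0. Qed.

Definition relator_monoid : monoid := Defs.Monoid nfmulA nfmul1m nfmulm1.

(** * Idempotents and their maximal subgroups *)

Lemma irreducible_val (x : relator_monoid) : irreducible (val x).
Proof. exact/nf_idP/eqP/(valP x). Qed.

(** In [e = p q = r s] with [e e] reducing to [p s], idempotency gives [p q = p s], hence [s = q];
    then [r = p] by length, and [q r = 1] reads [q p = 1]. *)
Lemma idempotent_factor (e : relator_monoid) : idempotent_elt e ->
  exists p q : relator_monoid, mmul q p = mone relator_monoid /\ mmul p q = e.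
Proof.
move=> /(congr1 val) /= ee.
have [p [q [r [s [def_e def_e' def_ee qr1 _]]]]] :=
  irreducible_mul (@irreducible_val e) (@irreducible_val e).
have [eq_rp eq_sq] : r = p /\ s = q.
  have /eqP : p ++ q = p ++ s by rewrite -def_e -def_ee ee.
  rewrite eqseq_cat // eqxx => /eqP def_q; split => //.
  have eq_size : size p = size r.
    by have := congr1 size def_e'; rewrite def_e def_q !size_cat => /addIn.
  by move/eqP: def_e'; rewrite def_e def_q eqseq_cat // => /andP[/eqP].
exists (mk p), (mk q); split; rewrite /= nfmul_mk.
  by rewrite -eq_rp; apply: eq_mk.
by rewrite -def_e mk_val.
Qed.

(** Conjugation [z -> q z p] maps the H-class of [p q] onto the units, [x -> p x q] giving
    preimages, so it carries generators to generators. *)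
Lemma fg_maximal_subgroup_conj (M : monoid) (p q : M) : mmul q p = mone M ->
  fg_maximal_subgroup (mmul p q) -> fg_maximal_subgroup (mone M).
Proof.
move=> qp1 [gs [gsH gsP]].
pose phi z := mmul q (mmul z p).
have mulpK x : mmul q (mmul p x) = x by rewrite mmulA qp1 mmul1m.
have phiM z t : Hclass (mmul p q) z -> phi (mmul z t) = mmul (phi z) (phi t).
  move=> [_ [_ [[s ->] _]]].
  by rewrite /phi -!mmulA !mulpK.
have phi1 : phi (mmul p q) = mone M by rewrite /phi -!mmulA !mulpK.
have phiH z : Hclass (mmul p q) z -> Hclass (mone M) (phi z).
  move=> Hz; have [[s zs] [[t zt] [[s' zs'] [t' zt']]]] := Hz.
  split; first by exists (phi z); rewrite mmul1m.
  split; first by exists (phi t); rewrite -phiM // -zt phi1.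
  split; first by exists (phi z); rewrite mmulm1.
  exists (phi t').
  (* [t'] is not known to lie in the H-class, so [phiM] is replaced by the absorption of [p q] in
     [z = p q s]. *)
  have <- : phi (mmul t' z) = mone M by rewrite -zt' phi1.
  rewrite zs /phi -!mmulA; congr mmul.
  by rewrite !mulpK.
exists (List.map phi gs); split=> [y /in_map_iff[g [<- /gsH/phiH //]]|x Hx].
have Hpxq : Hclass (mmul p q) (mmul p (mmul x q)).
  have [_ [[y xy] [_ [z zx]]]] := Hx.
  split; first by exists (mmul p (mmul x q)); rewrite -!mmulA mulpK.
  split.
    exists (mmul p (mmul y q)).
    by rewrite -!mmulA mulpK (mmulA x) -xy mmul1m.
  split; first by exists (mmul p (mmul x q)); rewrite -!mmulA mulpK.
  exists (mmul p (mmul z q)).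
  by rewrite -!mmulA mulpK (mmulA z) -zx mmul1m.
have [zs [zsP def_x]] := gsP _ Hpxq.
exists (List.map phi zs); split=> [y /in_map_iff[z [<- z_zs]]|].
  have [z_gs|[g g_gs [Hz [gz zg]]]] := zsP z z_zs.
    by left; apply: in_map.
  right; exists (phi g); first exact: in_map.
  split; first exact: phiH.
  by rewrite -!phiM ?gz ?zg ?phi1 //; apply: gsH.
have -> : x = phi (mmul p (mmul x q)) by rewrite /phi -!mmulA qp1 mmulm1 mulpK.
rewrite def_x; elim: zs zsP {def_x} => //= z zs IHzs zsP.
rewrite phiM ?IHzs // => [t t_zs|]; first by apply: zsP; right.
by have [|/gsH|[g _ []]] := zsP z; first by left.
Qed.

(** * The group of units is not finitely generated *)

Lemma unit_flatten_unitw (x y : relator_monoid) :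
    mmul x y = mone relator_monoid -> mmul y x = mone relator_monoid ->
  exists ns, x = mk (flatten (map unitw ns)).
Proof.
move=> /(congr1 val) /= xy /(congr1 val) /= yx.
(* From [x y = 1] the surviving part [p] of [x] is empty, giving the prefix condition on [x]; from
   [y x = 1] the part [s'] is empty, giving the suffix condition. *)
have [p [q [r [s [def_x _ def_xy _ [pq _]]]]]] :=
  irreducible_mul (@irreducible_val x) (@irreducible_val y).
have [p' [q' [r' [s' [_ def_x' def_yx _ [_ pr']]]]]] :=
  irreducible_mul (@irreducible_val y) (@irreducible_val x).
move: def_xy def_yx; rewrite xy yx => /esym/nilP; rewrite cat_nilp => /andP[/nilP p0 _].
move=> /esym/nilP; rewrite cat_nilp => /andP[_ /nilP s0].
have [||ns def_ns] := @path_unitw (val x).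
- by rewrite def_x p0.
- by rewrite def_x' s0 cats0.
by exists ns; rewrite -def_ns mk_val.
Qed.

Lemma flatten_unitw_rev ns :
  mmul (mk (flatten (map unitw ns)) : relator_monoid)
    (mk (flatten (map unitw (rev ns)))) = mone relator_monoid.
Proof.
rewrite /= nfmul_mk; elim/last_ind: ns => //= ns n IHns.
rewrite rev_rcons map_rcons flatten_rcons -catA -IHns.
by apply: eq_mk; rewrite -[RHS](nf_relator _ n) /relator -!catA.
Qed.

Lemma not_fg_units : ~ fg_maximal_subgroup (mone relator_monoid).
Proof.
move=> [gs [gsH gsP]]; set one := mone _ in gsH gsP.
pose bounded N (x : relator_monoid) :=
  exists2 ns, all (gtn N) ns & x = mk (flatten (map unitw ns)).
have unitH x : Hclass one x -> exists y, mmul x y = one /\ mmul y x = one.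
  move=> [_ [[y xy] [_ [z zx]]]]; exists y; split=> //.
  suff -> : y = z by [].
  by rewrite -(mmul1m y) -/one zx -mmulA -xy /one mmulm1.
have unit_flatten x : Hclass one x -> exists ns, x = mk (flatten (map unitw ns)).
  by move=> /unitH[y [xy yx]]; apply: unit_flatten_unitw xy yx.
have [N gsN] : exists N, forall g, In g gs -> bounded N g.
  elim: gs gsH {gsP} => [|g gs IHgs] gsH; first by exists 0.
  have [|N gsN] := IHgs; first by move=> h h_gs; apply: gsH; right.
  have [ns ->] := unit_flatten g (gsH g (or_introl erefl)).
  (* Every index in [ns] is at most [sumn ns]. *)
  exists (N + (sumn ns).+1) => _ [<-|/gsN[ms lt_ms ->]].
    exists ns => //; apply/allP => n n_ns /=.
    by rewrite ltn_addl // ltnS; elim: ns n_ns => //= m ns IHns;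
      rewrite inE => /orP[/eqP->|/IHns]; lia.
  exists ms => //; apply/allP => m /(allP lt_ms) /=; lia.
have boundedV x y : bounded N x -> mmul x y = one -> bounded N y.
  move=> [ns lt_ns ->] xy; exists (rev ns); first by rewrite all_rev.
  have := flatten_unitw_rev (rev ns); rewrite revK => yx.
  by rewrite -(mmul1m y) -yx -mmulA xy mmulm1.
have boundedM x y : bounded N x -> bounded N y -> bounded N (mmul x y).
  move=> [ns lt_ns ->] [ms lt_ms ->]; exists (ns ++ ms); first by rewrite all_cat lt_ns.
  by rewrite map_cat flatten_cat /= nfmul_mk.
have UN2 : mmul (mk (unitw N) : relator_monoid) (mk (unitw N)) = one.
  have := flatten_unitw_rev [:: N].
  by rewrite /= cats0.
have [|zs [zsP]] := gsP (mk (unitw N)).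
  split; first by exists (mk (unitw N)); rewrite mmul1m.
  split; first by exists (mk (unitw N)).
  split; first by exists (mk (unitw N)); rewrite mmulm1.
  by exists (mk (unitw N)).
suff : bounded N (foldr (@mmul relator_monoid) one zs).
  move=> [ns /allP lt_ns ->] /(congr1 val) /=.
  have [ms sub_ms ->] := nf_flatten_unitw ns.
  (* If a product with indices below [N] reduces to [U_N], its last index is [N], which is
     absurd. *)
  rewrite nf_unitw; case/lastP: ms sub_ms => // ms n sub_ms.
  rewrite map_rcons flatten_rcons => /(@eq_cat_unitw [::])[_ def_N].
  have /sub_ms/lt_ns : n \in rcons ms n by rewrite mem_rcons mem_head.
  by rewrite -def_N /= ltnn.
elim: zs zsP => [|z zs IHzs] zsP /=; first by exists [::].
apply: boundedM; last by apply: IHzs => t t_zs; apply: zsP; right.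
have [/gsN//|[g /gsN g_b [_ [gz _]]]] := zsP z (or_introl erefl).
exact: boundedV gz.
Qed.

(* Derivations as a least fixed point of the rules *)
Scheme derives_mut := Minimality for derives Sort Prop
with derives_form_mut := Minimality for derives_form Sort Prop.

(** The language of a sentential form once each nonterminal [n] is interpreted by [I n]; it lets
    rules be read as closure conditions on [I]. *)
Fixpoint form_language (S N : Type) (I : N -> seq S -> Prop)
    (f : seq (N + S)) (w : seq S) : Prop :=
  match f with
  | [::] => w = [::]
  | inr a :: f' => exists2 w', w = a :: w' & form_language I f' w'
  | inl n :: f' => exists u v, [/\ w = u ++ v, I n u & form_language I f' v]
  end.

Lemma derives_sound (S : finType) (G : cfgrammar S)
    (I : nonterm G -> seq S -> Prop) :
    (forall n rhs w, (n, rhs) \in rules G -> form_language I rhs w -> I n w) ->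
  forall n w, derives n w -> I n w.
Proof.
move=> closedI n w; apply: (@derives_mut S G I (form_language I)) => //=.
- by move=> m rhs u /closedI clI _ /clI.
- by move=> a f u _ fu; exists u.
- by move=> m f u v _ mu _ fv; exists u, v.
Qed.

Lemma derives_form_complete (S : finType) (G : cfgrammar S) f w :
  form_language (@derives S G) f w -> derives_form f w.
Proof.
elim: f w => [|[n|a] f IHf] w /= => [->|[u [v [-> nu /IHf fv]]]|[v -> /IHf fv]].
- exact: df_nil.
- exact: df_nonterm.
- exact: df_term.
Qed.

Lemma derivesI (S : finType) (G : cfgrammar S) n rhs w : (n, rhs) \in rules G ->
  form_language (@derives S G) rhs w -> derives n w.
Proof. by move=> rhsG /derives_form_complete; apply: derives_rule. Qed.

(** * A grammar for the word problem *)

Local Notation symbol := (option letter).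
Local Notation nont := (option (bool * bool)).

(* [None] is the start symbol, [Some (false, false)] generates the words equal
   to 1 and [Some (true, false)] those equal to some [b^n c a b^n]; the second
   bit selects the nonterminals of the reversed languages. *)
Definition wp_rules : seq (nont * seq (nont + symbol)) :=
  let D m : nont + symbol := inl (Some (false, m)) in
  let T m : nont + symbol := inl (Some (true, m)) in
  let t (x : letter) : nont + symbol := inr (Some x) in
  [:: (None, [:: inr None]);
      (None, [:: D false; inl None]);
      (None, [:: inl None; D true])] ++
  [seq (None, [:: t x; inl None; t x]) | x <- [:: la; lb; lc]] ++
  flatten [seq
    [:: (Some (false, m), [::]);
        (Some (false, m), [:: D m; D m]);
        (Some (false, m), [:: t (Some (~~ m)); T m; t (Some m)]);
        (Some (true, m), [:: D m; T m]);
        (Some (true, m), [:: T m; D m]);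
        (Some (true, m), [:: t lb; T m; t lb]);
        (Some (true, m), [:: t (Some m); D m; t (Some (~~ m))])]
    | m <- [:: false; true]].

Definition wp_grammar : cfgrammar symbol := CFG None wp_rules.

Local Notation gen := (@derives symbol wp_grammar).

(** The rules as closure conditions, of which [gen] is the least solution. [Some (~~ m)] and
    [Some m] are [a] and [c] for [m = false], and are exchanged in the mirrored rules. *)
Record wp_closed (I : nont -> seq symbol -> Prop) : Prop := WpClosed {
  wp_sharp : I None [:: None];
  wp_DS u v : I (Some (false, false)) u -> I None v -> I None (u ++ v);
  wp_SD u v : I None u -> I (Some (false, true)) v -> I None (u ++ v);
  wp_xSx x u : I None u -> I None (Some x :: u ++ [:: Some x]);
  wp_nil m : I (Some (false, m)) [::];
  wp_DD m u v : I (Some (false, m)) u -> I (Some (false, m)) v ->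
    I (Some (false, m)) (u ++ v);
  wp_aTc m u : I (Some (true, m)) u ->
    I (Some (false, m)) (Some (Some (~~ m)) :: u ++ [:: Some (Some m)]);
  wp_DT m u v : I (Some (false, m)) u -> I (Some (true, m)) v ->
    I (Some (true, m)) (u ++ v);
  wp_TD m u v : I (Some (true, m)) u -> I (Some (false, m)) v ->
    I (Some (true, m)) (u ++ v);
  wp_bTb m u : I (Some (true, m)) u ->
    I (Some (true, m)) (Some lb :: u ++ [:: Some lb]);
  wp_cDa m u : I (Some (false, m)) u ->
    I (Some (true, m)) (Some (Some m) :: u ++ [:: Some (Some (~~ m))]) }.

Lemma form_language2 (S N : Type) (I : N -> seq S -> Prop) n1 n2 u v :
  I n1 u -> I n2 v -> form_language I [:: inl n1; inl n2] (u ++ v).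
Proof. by exists u, v; split=> //; exists v, [::]; rewrite cats0. Qed.

Lemma form_language_bracket (S N : Type) (I : N -> seq S -> Prop) n x y u :
  I n u -> form_language I [:: inr x; inl n; inr y] (x :: u ++ [:: y]).
Proof. by exists (u ++ [:: y]) => //; exists u, [:: y]; split=> //; exists [::]. Qed.

Lemma gen_closed : wp_closed gen.
Proof.
split.
- by apply: (@derivesI symbol wp_grammar _ [:: inr None]) => //; exists [::].
- by move=> u v Iu Iv; apply: derivesI (form_language2 Iu Iv).
- by move=> u v Iu Iv; apply: derivesI (form_language2 Iu Iv).
- by move=> x u Iu; apply: derivesI (form_language_bracket _ _ Iu); case: x => [[]|].
- by move=> m; apply: (@derivesI symbol wp_grammar _ [::]) => //; case: m.
- by move=> m u v Iu Iv; apply: derivesI (form_language2 Iu Iv); case: m {Iu Iv}.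
- by move=> m u Iu; apply: derivesI (form_language_bracket _ _ Iu); case: m {Iu}.
- by move=> m u v Iu Iv; apply: derivesI (form_language2 Iu Iv); case: m {Iu Iv}.
- by move=> m u v Iu Iv; apply: derivesI (form_language2 Iu Iv); case: m {Iu Iv}.
- by move=> m u Iu; apply: derivesI (form_language_bracket _ _ Iu); case: m {Iu}.
- by move=> m u Iu; apply: derivesI (form_language_bracket _ _ Iu); case: m {Iu}.
Qed.

Lemma gen_ind (I : nont -> seq symbol -> Prop) :
  wp_closed I -> forall n w, gen n w -> I n w.
Proof.
case=> Isharp IDS ISD IxSx Inil IDD IaTc IDT ITD IbTb IcDa.
have two n1 n2 w : form_language I [:: inl n1; inl n2] w ->
    exists u v, [/\ w = u ++ v, I n1 u & I n2 v].
  by move=> [u [_ [-> Iu [v [_ [-> Iv ->]]]]]]; exists u, v; rewrite cats0.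
have bracket n x y w : form_language I [:: inr x; inl n; inr y] w ->
    exists2 u, w = x :: u ++ [:: y] & I n u.
  by move=> [_ -> [u [_ [-> Iu [_ -> ->]]]]]; exists u.
apply: (@derives_sound symbol wp_grammar) => n rhs w.
rewrite /rules /= !inE.
(* Each right-hand side is empty, the separator alone, two nonterminals, or a nonterminal between
   two letters. *)
do ![case/orP] => /eqP[-> ->].
all: try by [move=> /two[u [v [-> Iu Iv]]]; auto | move=> /= ->; auto
  | move=> [_ -> ->]; auto].
all: move=> /bracket[u -> Iu].
all: by [apply: IxSx | apply: IbTb | apply: (IaTc false) | apply: (IaTc true)
  | apply: (IcDa false) | apply: (IcDa true)].
Qed.

(** * Soundness of the grammar *)

Definition mirror (m : bool) (u : seq letter) := if m then rev u else u.

Lemma mirror_cat m u v :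
  mirror m u ++ mirror m v = if m then mirror m (v ++ u) else mirror m (u ++ v).
Proof. by case: m => //=; rewrite rev_cat. Qed.

(** The part of [relator n] strictly between its first [a] and its last [c]. *)
Definition midword n : seq letter := nseq n lb ++ [:: lc; la] ++ nseq n lb.

Lemma midwordS n : midword n.+1 = lb :: midword n ++ [:: lb].
Proof.
have nseqSr : nseq n.+1 lb = nseq n lb ++ [:: lb] by rewrite -(addn1 n) nseqD.
by rewrite /midword {2}nseqSr -!catA.
Qed.

Lemma relator_midword n : relator n = la :: midword n ++ [:: lc].
Proof. by rewrite /relator {2}unitw_rcons -cats1 /unitw /= cat_rcons /midword -!catA. Qed.

Lemma nf_congr u u' v v' : nf u = nf u' -> nf v = nf v' -> nf (u ++ v) = nf (u' ++ v').
Proof. by move=> eq_u eq_v; rewrite -nf_catl -nf_catr eq_u eq_v nf_catl nf_catr. Qed.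

Definition wp_interp (n : nont) (w : seq symbol) : Prop :=
  match n with
  | None => exists u v, nf u = nf v /\ w = map Some u ++ None :: map Some (rev v)
  | Some (false, m) => exists2 u, w = map Some (mirror m u) & nf u = [::]
  | Some (true, m) =>
      exists2 u, w = map Some (mirror m u) & exists k, nf u = nf (midword k)
  end.

Lemma wp_interp_closed : wp_closed wp_interp.
Proof.
split.
- by exists [::], [::].
- move=> _ _ [u -> u1] [v [v' [eq_v ->]]]; exists (u ++ v), v'.
  by rewrite -nf_catl u1 map_cat -catA.
- move=> _ _ [v [v' [eq_v ->]]] [u -> u1]; exists v, (u ++ v').
  by rewrite -nf_catl u1 rev_cat map_cat -catA.
- move=> x _ [u [v [eq_uv ->]]]; exists (x :: u), (x :: v); split.
    exact: (@nf_congr [:: x] [:: x]).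
  by rewrite rev_cons -cats1 map_cat /= -!catA.
- by move=> m; exists [::] => //; case: m.
- move=> m _ _ [u -> u1] [v -> v1]; rewrite -map_cat mirror_cat.
  by case: m; [exists (v ++ u) | exists (u ++ v)]; rewrite // -nf_catl ?u1 ?v1.
- move=> m _ [u -> [k uk]].
  exists (la :: u ++ [:: lc]); last first.
    transitivity (nf (relator k)).
      by rewrite relator_midword; apply: (@nf_congr [:: la] [:: la]) => //; apply: nf_congr.
    by rewrite -[relator k]cats0 (nf_relator [::]).
  by case: m; rewrite /= ?rev_cons ?rev_cat ?map_rcons -?cats1 /= ?map_cat.
- move=> m _ _ [u -> u1] [v -> [k vk]]; rewrite -map_cat mirror_cat.
  case: m; [exists (v ++ u) | exists (u ++ v)] => //; exists k.
    by rewrite -nf_catr u1 cats0.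
  by rewrite -nf_catl u1.
- move=> m _ _ [u -> [k uk]] [v -> v1]; rewrite -map_cat mirror_cat.
  case: m; [exists (v ++ u) | exists (u ++ v)] => //; exists k.
    by rewrite -nf_catl v1.
  by rewrite -nf_catr v1 cats0.
- move=> m _ [u -> [k uk]].
  exists (lb :: u ++ [:: lb]); last first.
    exists k.+1; rewrite midwordS.
    by apply: (@nf_congr [:: lb] [:: lb]) => //; apply: nf_congr.
  by case: m; rewrite /= ?rev_cons ?rev_cat ?map_rcons -?cats1 /= ?map_cat.
- move=> m _ [u -> u1].
  exists (lc :: u ++ [:: la]); last first.
    by exists 0; apply: (@nf_congr [:: lc] [:: lc]) => //; rewrite -nf_catl u1.
  by case: m; rewrite /= ?rev_cons ?rev_cat ?map_rcons -?cats1 /= ?map_cat.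
Qed.

(** * Completeness of the grammar *)

Definition rev_interp (n : nont) (w : seq symbol) : Prop :=
  if n is Some (t, m) then gen (Some (t, ~~ m)) (rev w) else True.

(** Reversal swaps the factors in each rule and exchanges the outer [a] and [c], which yields the
    rules for the opposite bit. *)
Lemma rev_interp_closed : wp_closed rev_interp.
Proof.
have [_ _ _ _ Inil IDD IaTc IDT ITD IbTb IcDa] := gen_closed.
split=> //= [m u v Iu Iv|m u Iu|m u v Iu Iv|m u v Iu Iv|m u Iu|m u Iu].
all: rewrite ?rev_cons ?rev_cat ?rcons_cat /= -?cats1.
- exact: IDD.
- by have := IaTc _ _ Iu; rewrite negbK.
- exact: ITD.
- exact: IDT.
- exact: IbTb.
- by have := IcDa _ _ Iu; rewrite negbK.
Qed.

(** [u] is [w] with a generated word equal to 1 inserted in each gap, including both ends. *)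
Fixpoint inserted (w u : seq letter) : Prop :=
  match w with
  | [::] => gen (Some (false, false)) (map Some u)
  | x :: w' => exists d u', [/\ u = d ++ x :: u',
      gen (Some (false, false)) (map Some d) & inserted w' u']
  end.

Lemma inserted_catP w1 w2 u : inserted (w1 ++ w2) u ->
  exists u1 u2, [/\ u = u1 ++ u2, inserted w1 u1 & inserted w2 u2].
Proof.
elim: w1 u => [|x w1 IHw] u /=.
  by exists [::], u; split=> //; apply: wp_nil gen_closed _.
move=> [d [u' [-> Dd /IHw[u1 [u2 [-> I1 I2]]]]]].
by exists (d ++ x :: u1), u2; split=> //; [rewrite -catA|exists d, u1].
Qed.

Lemma inserted_catl d w u : gen (Some (false, false)) (map Some d) ->
  inserted w u -> inserted w (d ++ u).
Proof.
move=> Dd; case: w => [|x w] /=.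
  by rewrite map_cat; apply: wp_DD gen_closed _ _ _ Dd.
move=> [e [u' [-> De Iu]]]; exists (d ++ e), u'; split=> //; first by rewrite catA.
by rewrite map_cat; apply: wp_DD gen_closed _ _ _ Dd De.
Qed.

Lemma inserted_cat w1 w2 u1 u2 : inserted w1 u1 -> inserted w2 u2 ->
  inserted (w1 ++ w2) (u1 ++ u2).
Proof.
elim: w1 u1 => [|x w1 IHw] u1 /=; first exact: inserted_catl.
move=> [d [u' [-> Dd Iu']]] I2; exists d, (u' ++ u2).
by rewrite -catA; split=> //; apply: IHw.
Qed.

(** The outer pair of [b] is peeled off at each step; insertions beside it are absorbed by [wp_DT]
    and [wp_TD]. *)
Lemma inserted_midword n u : inserted (midword n) u -> gen (Some (true, false)) (map Some u).
Proof.
have [_ _ _ _ Inil IDD IaTc IDT ITD IbTb IcDa] := gen_closed.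
elim: n u => [|n IHn] u.
  move=> [d1 [_ [-> D1 [d2 [d3 [-> D2 D3]]]]]].
  rewrite map_cat; apply: IDT => //.
  have -> : map Some (lc :: d2 ++ la :: d3) =
      (Some lc :: map Some d2 ++ [:: Some la]) ++ map Some d3.
    by rewrite /= map_cat -catA.
  by apply: ITD => //; apply: (IcDa false).
rewrite midwordS => -[d1 [v' [-> D1 /inserted_catP[v [v'' [-> /IHn Tv]]]]]].
move=> [d2 [d3 [-> D2 D3]]].
rewrite map_cat; apply: IDT => //.
have -> : map Some (lb :: v ++ d2 ++ lb :: d3) =
    (Some lb :: (map Some v ++ map Some d2) ++ [:: Some lb]) ++ map Some d3.
  by rewrite /= !map_cat -!catA.
by apply: (ITD) => //; apply: IbTb; apply: ITD.
Qed.

Lemma inserted_relator n u : inserted (relator n) u -> gen (Some (false, false)) (map Some u).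
Proof.
have [_ _ _ _ Inil IDD IaTc IDT ITD IbTb IcDa] := gen_closed.
rewrite relator_midword => -[d1 [v' [-> D1 /inserted_catP[v [v'' [-> /inserted_midword Tv]]]]]].
move=> [d2 [d3 [-> D2 D3]]].
rewrite map_cat; apply: (IDD) => //.
have -> : map Some (la :: v ++ d2 ++ lc :: d3) =
    (Some la :: (map Some v ++ map Some d2) ++ [:: Some lc]) ++ map Some d3.
  by rewrite /= !map_cat -!catA.
by apply: IDD => //; apply: (IaTc false); apply: ITD.
Qed.

(** When [push] deletes a relator, that relator with its insertions is itself generated as a word
    equal to 1, so it becomes one more insertion. *)
Lemma inserted_nf u : inserted (nf u) u.
Proof.
elim/last_ind: u => [|u x IHu]; first exact: wp_nil gen_closed _.
have : inserted (rcons (nf u) x) (rcons u x).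
  rewrite -!cats1; apply: inserted_cat => //.
  by exists [::], [::]; split=> //; apply: wp_nil gen_closed _.
rewrite /nf foldl_rcons -/(nf u); case: pushP => [n t ->|//].
move=> /inserted_catP[u1 [u2 [-> I1 /inserted_relator D2]]].
by rewrite -(cats0 t); apply: inserted_cat.
Qed.

(** The letters of the common word [w] are produced in pairs from the outside in; insertions of [u]
    come from the plain nonterminal on the left, those of [v] reversed from the mirrored one on the
    right. *)
Lemma gen_word_problem w u v : inserted w u -> inserted w v ->
  gen None (map Some u ++ None :: map Some (rev v)).
Proof.
have [Isharp IDS ISD IxSx _ _ _ _ _ _ _] := gen_closed.
have revD d : gen (Some (false, false)) (map Some d) ->
    gen (Some (false, true)) (map Some (rev d)).
  by move=> /(gen_ind rev_interp_closed) /=; rewrite map_rev.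
elim: w u v => [|x w IHw] u v.
  by move=> Du Dv; apply: IDS => //; apply: (ISD [:: None]) => //; apply: revD.
move=> [d [u' [-> Dd Iu]]] [e [v' [-> De Iv]]].
rewrite map_cat -catA rev_cat rev_cons map_cat map_rcons; apply: IDS => //.
have -> : map Some (x :: u') ++ None :: rcons (map Some (rev v')) (Some x)
      ++ map Some (rev e) =
    (Some x :: (map Some u' ++ None :: map Some (rev v')) ++ [:: Some x])
      ++ map Some (rev e).
  by rewrite -cats1 /= -!catA /= -?catA.
by apply: ISD; [apply/IxSx/IHw|apply: revD].
Qed.

(** * The word problem is context-free, and the conclusion *)

Lemma mword_letters u : mword (fun x => mk [:: x] : relator_monoid) u = mk u.
Proof. by elim: u => //= x u ->; rewrite nfmul_mk. Qed.

Lemma context_free_relator_monoid : context_free_monoid relator_monoid.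
Proof.
exists letter, (fun x => mk [:: x]); split.
  by move=> m; exists (val m); rewrite mword_letters mk_val.
exists wp_grammar => w; split=> [[u [v [eq_uv ->]]]|/(gen_ind wp_interp_closed)].
  move: eq_uv; rewrite !mword_letters => /(congr1 val) /= eq_uv.
  apply: (@gen_word_problem (nf u)); first exact: inserted_nf.
  by rewrite eq_uv; apply: inserted_nf.
move=> [u [v [eq_uv ->]]]; exists u, v; split=> //.
by rewrite !mword_letters; apply: eq_mk.
Qed.

Theorem mainTheorem1 :
  exists M : monoid, context_free_monoid M /\
    forall e : M, idempotent_elt e -> ~ fg_maximal_subgroup e.
Proof.
exists relator_monoid; split; first exact: context_free_relator_monoid.
move=> e /idempotent_factor[p [q [qp1 <-]]] /(fg_maximal_subgroup_conj qp1).
exact: not_fg_units.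
Qed.
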